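(* No infinite-dimensional strict $(LF)$-space is a Gâteaux Differentiability Space.
   Context: All vector spaces are real; all topological vector spaces are Hausdorff; ''lcs'' means locally convex space. A lcs $E$ is a Gâteaux Differentiability Space (GDS) if every continuous convex function $f:D\to\mathbb{R}$, where $D\subset E$ is a nonempty open convex set, is Gâteaux differentiable on a dense subset of $D$. Here $f$ is Gâteaux differentiable at $x\in D$ if there is $x^*\in E'$ with $\lim_{t\to 0}\frac{f(x+ty)-f(x)}{t}=x^*(y)$ for every $y\in E$. A Fréchet space is a metrizable and complete lcs. Let $(E_n,\tau_n)_n$ be an increasing sequence of lcs such that $\tau_{n+1}|E_n\le\tau_n$ for all $n$. If $E=\bigcup_n E_n$, then $E$ with the finest locally convex topology $\tau$ such that $\tau|E_n\le\tau_n$ for all $n$ is the inductive limit of the sequence. If each $(E_n,\tau_n)$ is a Fréchet space and $E_n\subsetneq E_{n+1}$ for all $n$, the limit is called an $(LF)$-space; if further $\tau_{n+1}|E_n=\tau_n$ for each $n$, it is called strict. *)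

(* Defs.v *)
From HB Require Import structures.
From mathcomp Require Import all_boot all_order all_algebra.
From mathcomp Require Import all_classical all_reals all_analysis.
Import Order.TTheory GRing.Theory Num.Theory.
Import numFieldNormedType.Exports.

Set Implicit Arguments.
Unset Strict Implicit.
Unset Printing Implicit Defensive.

Local Open Scope classical_set_scope.
Local Open Scope ring_scope.

(* A locally convex space (lcs) is a [tvsType R] (which bundles local
   convexity) satisfying [hausdorff_space].

   Pitfall: the uniform structure carried by a [tvsType] is only required to
   induce the topology; it need not be the translation-invariant one.  Hence
   nothing below refers to [entourage], [cauchy] or [completeType]. *)

(** ** Gateaux differentiability spaces *)

(* [f] is total, but when [x] lies in an open set [D] only the values of [f]
   on [D] matter. *)
Definition gateaux_differentiable_at (R : realType) (E : tvsType R)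
    (f : E -> R^o) (x : E) : Prop :=
  exists2 l : {linear E -> R^o}, continuous l &
    forall y : E, (fun t : R => (f (x + t *: y) - f x) / t) @ 0^' --> l y.

Definition gateaux_differentiability_space (R : realType) (E : tvsType R) :
    Prop :=
  forall (D : set E) (f : E -> R^o),
    D !=set0 -> open D -> convex_set D ->
    {within D, continuous f} -> convex_function D f ->
    D `<=` closure (D `&` [set x | gateaux_differentiable_at f x]).

(** ** Frechet spaces *)

Definition metrizable (R : realType) (T : topologicalType) : Prop :=
  exists d : T -> T -> R,
    [/\ forall x y, d x y = 0 <-> x = y,
        forall x y, d x y = d y x,
        forall x y z, d x z <= d x y + d y z &
        forall x, nbhs x =
          filter_from [set e : R | 0 < e] (fun e => [set y | d x y < e])].

Definition tvs_cauchy (R : realType) (E : tvsType R) (F : set_system E) :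
    Prop :=
  forall U : set E, nbhs 0 U ->
    exists2 A, F A & forall x y, A x -> A y -> U (x - y).

Definition tvs_complete (R : realType) (E : tvsType R) : Prop :=
  forall F : set_system E, ProperFilter F -> tvs_cauchy F ->
    exists x : E, F --> x.

Definition frechet_space (R : realType) (E : tvsType R) : Prop :=
  [/\ hausdorff_space E, metrizable R E & tvs_complete E].

(** ** Inductive limits of sequences *)

(* A linear subspace of [E] with a topology of its own is given by a space
   [V] and an injective linear map [i : V -> E]; the subspace is [range i].
   For [range i] included in [range j], the following is the system of open
   sets of the topology of [W] restricted to [range i], read in [V]. *)
Definition restricted_open (E : Type) (V W : topologicalType)
    (i : V -> E) (j : W -> E) : set_system V :=
  [set i @^-1` (j @` U) | U in @open W].

Definition increasing_lcs_sequence (R : realType) (E : lmodType R)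
    (V : nat -> tvsType R) (i : forall n, {linear V n -> E}) : Prop :=
  [/\ forall n, hausdorff_space (V n),
      forall n, injective (i n),
      forall n, range (i n) `<=` range (i n.+1) &
      forall n, restricted_open (i n) (i n.+1) `<=` @open (V n)].

(* The last condition says that the topology of [E] is the finest one: every
   locally convex topology on the vector space [E] is the pull-back of that of
   some [F : tvsType R] along a linear bijection [phi : E -> F]; it restricts
   to a coarser topology on each [range (i n)] iff all [phi \o i n] are
   continuous, and it is coarser than that of [E] iff [phi] is continuous. *)
Definition inductive_limit (R : realType) (E : tvsType R)
    (V : nat -> tvsType R) (i : forall n, {linear V n -> E}) : Prop :=
  [/\ increasing_lcs_sequence i,
      \bigcup_n range (i n) = [set: E],
      forall n, continuous (i n) &
      forall (F : tvsType R) (phi : {linear E -> F}), bijective phi ->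
        (forall n, continuous (phi \o i n)) -> continuous phi].

Definition LF_sequence (R : realType) (E : tvsType R)
    (V : nat -> tvsType R) (i : forall n, {linear V n -> E}) : Prop :=
  [/\ inductive_limit i,
      forall n, frechet_space (V n) &
      forall n, range (i n) `<` range (i n.+1)].

Definition strict_LF_space (R : realType) (E : tvsType R) : Prop :=
  hausdorff_space E /\
  exists (V : nat -> tvsType R) (i : forall n, {linear V n -> E}),
    LF_sequence i /\
    forall n, restricted_open (i n) (i n.+1) = @open (V n).

Definition finite_dimensional (R : realType) (E : lmodType R) : Prop :=
  exists (n : nat) (v : 'I_n -> E),
    forall x : E, exists a : 'I_n -> R, x = \sum_(k < n) a k *: v k.

(* Main.v *)
(* Write [E] as the strict inductive limit of Frechet spaces [E_n] and choose
   [y_n] in [E_(n+1)] outside [E_n].  Being complete, [E_n] is closed in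
   [E_(n+1)], so some continuous seminorm of [E_(n+1)] vanishes on [E_n] but not
   at [y_n].  Since [E_n] carries the subspace topology, a continuous seminorm
   [p_n] of [E_n] extends to [E_(n+1)]; let [p_(n+1)] be the sum of such an
   extension and of the former seminorm.  The [p_n] glue to a seminorm [p] on
   [E], continuous because the topology of [E] is the finest one.  At a point of
   [E_n], [p] has a corner in the direction [y_n]; hence [p] is nowhere Gateaux
   differentiable. *)
Require Import Defs.
From HB Require Import structures.
From mathcomp Require Import all_boot all_order all_algebra.
From mathcomp Require Import all_classical all_reals all_analysis.
From mathcomp Require Import ring lra.
Import Order.TTheory GRing.Theory Num.Theory.
Import numFieldNormedType.Exports.

Set Implicit Arguments.
Unset Strict Implicit.
Unset Printing Implicit Defensive.

Local Open Scope classical_set_scope.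
Local Open Scope ring_scope.

(** * Seminorms on a real vector space *)

(** Only an upper bound is asked under scaling; equality, and with it nonnegativity, follows by
    scaling back with the inverse. *)
Record seminorm (R : realType) (E : lmodType R) (p : E -> R) : Prop :=
  Seminorm {
  seminormD : forall x y, p (x + y) <= p x + p y;
  seminormZ_le : forall a x, p (a *: x) <= `|a| * p x }.

Lemma seminormZ (R : realType) (E : lmodType R) (p : E -> R) (a : R) (x : E) :
  seminorm p -> p (a *: x) = `|a| * p x.
Proof.
move=> sp; apply/eqP; rewrite eq_le seminormZ_le //=.
have [->|a0] := eqVneq a 0.
  rewrite normr0 mul0r scale0r.
  have := seminormZ_le sp 2 0; rewrite scaler0 ger0_norm //; lra.
rewrite -[x in p x]scale1r -(mulVf a0) -scalerA.
rewrite (le_trans (ler_wpM2l _ (seminormZ_le sp _ _))) // mulrA -normrM.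
by rewrite mulfV // normr1 mul1r.
Qed.

Lemma seminorm0 (R : realType) (E : lmodType R) (p : E -> R) :
  seminorm p -> p 0 = 0.
Proof. by move=> sp; rewrite -(scale0r (0 : E)) seminormZ // normr0 mul0r. Qed.

Lemma seminormN (R : realType) (E : lmodType R) (p : E -> R) (x : E) :
  seminorm p -> p (- x) = p x.
Proof. by move=> sp; rewrite -scaleN1r seminormZ // normrN1 mul1r. Qed.

Lemma seminormB (R : realType) (E : lmodType R) (p : E -> R) (x y : E) :
  seminorm p -> p (x - y) = p (y - x).
Proof. by move=> sp; rewrite -(seminormN _ sp) opprB. Qed.

Lemma seminorm_ge0 (R : realType) (E : lmodType R) (p : E -> R) (x : E) :
  seminorm p -> 0 <= p x.
Proof.
move=> sp; have := seminormD sp x (- x).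
by rewrite subrr seminorm0 // seminormN //; lra.
Qed.

Lemma seminorm_distD (R : realType) (E : lmodType R) (p : E -> R)
    (y x z : E) : seminorm p -> p (x - z) <= p (x - y) + p (y - z).
Proof. by move=> sp; rewrite -(subrKA y) seminormD. Qed.

Lemma seminorm_sub (R : realType) (E : lmodType R) (p : E -> R) (x y : E) :
  seminorm p -> `|p x - p y| <= p (x - y).
Proof.
move=> sp; rewrite ler_norml; apply/andP; split.
  have := seminormD sp (y - x) x; rewrite subrK seminormB //; lra.
have := seminormD sp (x - y) y; rewrite subrK; lra.
Qed.

Lemma seminorm_add (R : realType) (E : lmodType R) (p q : E -> R) :
  seminorm p -> seminorm q -> seminorm (p \+ q).
Proof.
move=> sp sq; split=> [x y|a x] /=.
  by rewrite addrACA lerD // seminormD.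
by rewrite mulrDr lerD // seminormZ_le.
Qed.

Lemma seminorm_comp (R : realType) (E F : lmodType R) (j : {linear E -> F})
    (p : F -> R) : seminorm p -> seminorm (p \o j).
Proof.
move=> sp; split=> [x y|a x] /=; first by rewrite linearD seminormD.
by rewrite linearZ seminormZ_le.
Qed.

(** If [q x < p x], the vector [(p x)^-1 *: x] would have [q]-value below 1 and [p]-value 1. *)
Lemma seminorm_le_unit_ball (R : realType) (E : lmodType R) (p q : E -> R) :
  seminorm p -> seminorm q -> (forall x, q x < 1 -> p x < 1) ->
  forall x, p x <= q x.
Proof.
move=> sp sq qp x; rewrite leNgt; apply/negP => ltqp.
have p0 : 0 < p x by rewrite (le_lt_trans (seminorm_ge0 x sq)).
have := qp ((p x)^-1 *: x); rewrite !seminormZ // ger0_norm ?invr_ge0 ?ltW //.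
rewrite mulVf ?gt_eqF // ltxx -ltr_pdivlMl ?invr_gt0 // invrK mulr1.
by move=> /(_ ltqp).
Qed.

(** * Continuous seminorms and gauges *)

(** Scaling and translation carry the unit ball at 0 to every ball, so continuity of a seminorm can
    be recorded as one condition at 0. *)
Lemma nbhs_seminorm_ball (R : realType) (E : tvsType R) (p : E -> R)
    (x : E) (e : R) : seminorm p -> nbhs 0 [set z | p z < 1] -> 0 < e ->
  nbhs x [set y | p (y - x) < e].
Proof.
move=> sp np e0.
have e_neq0 : e != 0 by rewrite gt_eqF.
apply: filterS (nbhsT x (nbhs0Z e_neq0 np)) => _ [_ [z /= pz1 <-] <-].
by rewrite /= addrC addKr seminormZ // gtr0_norm // gtr_pMr.
Qed.

Lemma continuous_seminorm (R : realType) (E : tvsType R) (p : E -> R^o) :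
  seminorm p -> nbhs 0 [set z | p z < 1] -> continuous p.
Proof.
move=> sp np x; apply/cvgrPdist_lt => e e0.
apply: filterS (nbhs_seminorm_ball x sp np e0) => y /=.
by apply: le_lt_trans; rewrite (seminormB _ _ sp) seminorm_sub.
Qed.

Lemma convex_seminorm (R : realType) (E : lmodType R) (p : E -> R^o)
    (D : set E) : seminorm p -> convex_function D p.
Proof.
move=> sp t x y _ _; rewrite convRE (le_trans (seminormD sp _ _)) //.
by rewrite !(seminormZ _ _ sp) !ger0_norm // unstable.onem_ge0.
Qed.

(** Replaces the interval-typed coefficient in [convex_set] by a plain real with two bounds. *)
Lemma convex_setP (R : realType) (E : lmodType R) (A : set E) :
  convex_set A -> forall x y (t : R), A x -> A y -> 0 <= t -> t <= 1 ->
  A (t *: x + (1 - t) *: y).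
Proof.
move=> cA x y t Ax Ay t0 t1.
have t01 : Itv.spec (@Itv.num_sem R) (Itv.Real `[0%Z, 1%Z]) t.
  by rewrite /Itv.num_sem /= realE t0 /= in_itv /= t0 t1.
by have /set_mem := cA x y (Itv.mk t01) (mem_set Ax) (mem_set Ay).
Qed.

(** [p] is the Minkowski gauge of a symmetric convex neighborhood of 0 contained in [U]. *)
Lemma gauge_seminorm (R : realType) (E : tvsType R) (U : set E) :
  nbhs 0 U -> exists p : E -> R,
    [/\ seminorm p, nbhs 0 [set z | p z < 1] & [set z | p z < 1] `<=` U].
Proof.
move=> U0; have [B cB [Bo /(_ 0 U U0)[C [BC C0] CU]]] := @locally_convex R E.
have nC : nbhs 0 C by apply: open_nbhs_nbhs; split=> //; exact: Bo.
have {}cB := convex_setP (cB C (mem_set BC)).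
pose W : set E := C `&` (-%R @` C).
have nW : nbhs 0 W by apply: filterI => //; exact: nbhs0N.
have WN (x : E) : W x -> W (- x).
  by move=> [Cx [y Cy yx]]; split; [rewrite -yx opprK|exists x].
have Wconv (x y : E) (t : R) :
    W x -> W y -> 0 <= t -> t <= 1 -> W (t *: x + (1 - t) *: y).
  move=> [Cx [x' Cx' xE]] [Cy [y' Cy' yE]] t0 t1; split; first exact: cB.
  exists (t *: x' + (1 - t) *: y'); first exact: cB.
  by rewrite opprD -!scalerN xE yE.
have W0 : W 0 by exact: nbhs_singleton.
have Wstar (x : E) (t : R) : W x -> 0 <= t -> t <= 1 -> W (t *: x).
  by move=> Wx t0 t1; rewrite -[t *: x]addr0 -(scaler0 _ (1 - t)); exact: Wconv.
pose S x : set R := [set r | 0 < r /\ W (r^-1 *: x)].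
have Slb x : lbound (S x) 0 by move=> r [/ltW].
have SE x : S x !=set0.
  (* [W] absorbs [x]: continuity of scaling at [(0, x)] puts [(e / 2) *: x] in [W]. *)
  have := @scale_continuous R E (0, x) W; rewrite /= scale0r => /(_ nW).
  move=> -[[A A'] /= [/nbhs_ballP[e /= e0 eA] A'x] AW].
  exists (e / 2)^-1; split; first by rewrite invr_gt0 divr_gt0.
  rewrite invrK; apply: (AW (e / 2, x)); split=> /=; last exact: nbhs_singleton.
  apply: eA; rewrite -ball_normE /= sub0r normrN gtr0_norm ?divr_gt0 //; lra.
have Sinf x : has_inf (S x) by split=> //; exists 0.
pose p x := inf (S x).
have p_le x r : S x r -> p x <= r by move=> Sr; apply: ge_inf => //; exists 0.
have lt_p x r : p x < r -> exists2 s, S x s & s < r.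
  rewrite -subr_gt0 => /inf_adherent /(_ (Sinf x))[s Ss].
  by rewrite addrC subrK; exists s.
exists p; split; first split.
- move=> x y; apply/ler_addgt0Pr => e e0.
  have [r [r0 Wr] re] := lt_p x (p x + e / 2) ltac:(lra).
  have [s [s0 Ws] se] := lt_p y (p y + e / 2) ltac:(lra).
  have rs0 : 0 < r + s by lra.
  suff : S (x + y) (r + s) by move/p_le; lra.
  (* A convex combination of two points of [W], with weights [r / (r + s)] and [s / (r + s)]. *)
  split=> //; have -> : (r + s)^-1 *: (x + y) =
      (r / (r + s)) *: (r^-1 *: x) + (1 - r / (r + s)) *: (s^-1 *: y).
    rewrite scalerDr !scalerA; congr (_ *: _ + _ *: _); field; lra.
  apply: Wconv => //; first by rewrite divr_ge0 ?ltW.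
  by rewrite ler_pdivrMr // mul1r; lra.
- move=> a x; have [->|a0] := eqVneq a 0.
    rewrite scale0r normr0 mul0r; apply/ler_addgt0Pr => r r0; rewrite add0r.
    by apply: p_le; split=> //; rewrite scaler0.
  have a0' : 0 < `|a| by rewrite normr_gt0.
  rewrite -ler_pdivrMl //; apply: lb_le_inf => // r [r0 Wr].
  rewrite ler_pdivrMl //; apply: p_le; split; first by rewrite mulr_gt0.
  rewrite scalerA invfM mulrAC -scalerA.
  have [ap|an] := ltP 0 a.
    by rewrite gtr0_norm // mulVf // scale1r.
  by rewrite ler0_norm // invrN mulNr mulVf // scaleN1r; exact: WN.
(* On [W] the gauge is only known to be at most 1; halving [W] makes it strictly smaller. *)
- have half_neq0 : 2^-1 != 0 :> R by rewrite invr_eq0 pnatr_eq0.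
  apply: filterS (nbhs0Z half_neq0 nW) => _ [x Wx <-] /=.
  suff : S (2^-1 *: x) 2^-1 by move/p_le; lra.
  by split=> //; rewrite scalerA mulVf // scale1r.
- move=> x /= /lt_p[r [r0 Wr] r1]; apply: CU.
  suff [] : W x by [].
  rewrite -[x]scale1r -(mulfV (lt0r_neq0 r0)) -scalerA.
  by apply: Wstar => //; exact: ltW.
Qed.

(** * Extension of seminorms by infimal convolution *)

Section infimal_convolution.
Context {R : realType} {V W : lmodType R} (j : {linear V -> W}).
Context (p : V -> R) (s : W -> R) (sp : seminorm p) (ss : seminorm s).

(** The largest seminorm below [s] whose pull-back along [j] is below [p]. For [p = 0] it is the
    distance to [range j] measured by [s]. *)
Definition infconv (y : W) : R := inf [set p x + s (y - j x) | x in [set: V]].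

Let infconv_lb y : lbound [set p x + s (y - j x) | x in [set: V]] 0.
Proof. by move=> _ [x _ <-]; rewrite addr_ge0 // seminorm_ge0. Qed.

Let infconv_nonempty y : [set p x + s (y - j x) | x in [set: V]] !=set0.
Proof. by exists (p 0 + s (y - j 0)), 0. Qed.

Lemma infconv_le y x : infconv y <= p x + s (y - j x).
Proof. by apply: ge_inf; [exists 0; exact: infconv_lb|exists x]. Qed.

Lemma le_infconv y c : (forall x, c <= p x + s (y - j x)) -> c <= infconv y.
Proof. by move=> h; apply: lb_le_inf => // _ [x _ <-]. Qed.

Lemma infconv_ler y : infconv y <= s y.
Proof.
by rewrite (le_trans (infconv_le y 0)) // seminorm0 // linear0 subr0 add0r.
Qed.

Lemma infconv_lel x : infconv (j x) <= p x.
Proof. by rewrite (le_trans (infconv_le _ x)) // subrr (seminorm0 ss) addr0. Qed.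

(** Since [p x <= p y + p (x - y) <= p y + s (j x - j y)], the competitor [y = x] is optimal. *)
Lemma infconv_extends : (forall x, p x <= s (j x)) ->
  forall x, infconv (j x) = p x.
Proof.
move=> ps x; apply/eqP; rewrite eq_le infconv_lel le_infconv // => y.
rewrite -linearB; have := seminormD sp (x - y) y; rewrite subrK.
by have := ps (x - y); lra.
Qed.

(** Competitors add and scale: [x + x'] competes for [y + z], and [a *: x] for [a *: y]. *)
Lemma seminorm_infconv : seminorm infconv.
Proof.
split=> [y z|a y].
  rewrite -lerBlDr; apply: le_infconv => x; rewrite lerBlDr -lerBlDl.
  apply: le_infconv => x'; rewrite lerBlDl (le_trans (infconv_le _ (x + x'))) //.
  by rewrite linearD opprD (addrACA y) (addrACA (p x)) lerD // seminormD.
have [->|a0] := eqVneq a 0.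
  rewrite normr0 mul0r scale0r (le_trans (infconv_ler _)) //.
  by rewrite seminorm0.
have a0' : 0 < `|a| by rewrite normr_gt0.
rewrite -ler_pdivrMl //; apply: le_infconv => x.
rewrite ler_pdivrMl // (le_trans (infconv_le _ (a *: x))) //.
by rewrite linearZ -scalerBr (seminormZ _ _ sp) (seminormZ _ _ ss) mulrDr.
Qed.

End infimal_convolution.

(** * Subspace topologies and completeness *)

Definition inducing (V W : topologicalType) (j : V -> W) : Prop :=
  forall x A, nbhs x A <-> exists2 B, nbhs (j x) B & j @^-1` B `<=` A.

(** Injectivity of [i'] turns the trace of an open set, taken inside [E], into its preimage under
    [j]. *)
Lemma restricted_open_inducing (E : Type) (V W : topologicalType)
    (i : V -> E) (i' : W -> E) (j : V -> W) :
  injective i' -> (forall x, i' (j x) = i x) ->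
  restricted_open i i' = @open V -> inducing j.
Proof.
move=> i'inj ij io.
have pre U : i @^-1` (i' @` U) = j @^-1` U.
  apply/seteqP; split=> [x [y Uy]|x Ux]; last by exists (j x).
  by rewrite -ij => /i'inj; rewrite /preimage /= => <-.
move=> x A; split=> [|[B]].
  rewrite nbhsE => -[U [oU Ux] UA].
  move: oU; rewrite -io => -[G oG]; rewrite pre => UE.
  exists G; last by rewrite UE.
  by apply: open_nbhs_nbhs; split=> //; rewrite -UE in Ux.
rewrite nbhsE => -[G [oG Gx] GB] BA.
apply: (filterS (subset_trans (preimage_subset GB) BA)).
by apply: open_nbhs_nbhs; split=> //; rewrite -io; exists G; rewrite ?pre.
Qed.

(* The trace on [V] of the neighborhood filter of a point [y] in the closure of
   [range j] is a Cauchy filter; its limit [x] satisfies [j x = y]. *)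
Lemma complete_range_separated (R : realType) (V W : tvsType R)
    (j : {linear V -> W}) (y : W) :
  inducing j -> tvs_complete V -> hausdorff_space W -> ~ range j y ->
  exists2 U : set W, nbhs 0 U & forall x, ~ U (y - j x).
Proof.
move=> indj complV hausW yj; apply: contrapT => nsep.
(* Without a separating neighborhood, [y] is in the closure of [range j]: a [B] missing the range
   would give the separating set [y - B]. *)
have meet B : nbhs y B -> exists x, B (j x).
  move=> nB; apply: contrapT => hB; apply: nsep.
  have := nbhsB (- y) nB; rewrite addNr => /nbhs0N nU.
  exists (-%R @` (+%R (- y) @` B)) => // x [_ [b Bb <-]].
  rewrite opprD opprK => /addrI /oppr_inj bE.
  by apply: hB; exists x; rewrite -bE.
pose F : set_system V := [set A | exists2 B, nbhs y B & j @^-1` B `<=` A].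
have FF : ProperFilter F.
  apply: Build_ProperFilter_ex => [A [B /meet[x Bx] BA]|].
    by exists x; exact: BA.
  split=> [|A A' [B nB BA] [B' nB' BA']|A A' AA' [B nB BA]].
  - by exists setT => //; exact: filterT.
  - exists (B `&` B'); first exact: filterI.
    by move=> x [Bx B'x]; split; [exact: BA|exact: BA'].
  - by exists B => //; exact: subset_trans AA'.
have cauchyF : tvs_cauchy F.
  move=> U /indj[G]; rewrite linear0 => nG GU.
  (* Differences of points near [y] are near 0 in [W], and [indj] brings this back to [V]. *)
  have := @sub_continuous W (y, y) G; rewrite /= subrr => /(_ nG).
  move=> [[A A'] /= [nA nA'] AG].
  exists (j @^-1` (A `&` A')); first by exists (A `&` A') => //; exact: filterI.
  move=> x x' [Ax _] [_ A'x']; apply: GU; rewrite /= linearB.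
  exact: (AG (j x, j x')).
have [x Fx] := complV F FF cauchyF.
apply: yj; exists x => //; apply: hausW => A B nA nB.
have [B' nB' B'A] : F (j @^-1` A) by apply: Fx; apply/indj; exists A.
have [z [Bz B'z]] := meet _ (filterI nB nB').
by exists (j z); split=> //; exact: B'A.
Qed.

(** * Kinks and Gateaux differentiability *)

(** The symmetric second difference of [p] at [x] grows at least linearly in [|t|]; under Gateaux
    differentiability it would be [o(t)]. *)
Definition kink (R : realType) (E : lmodType R) (p : E -> R) (x y : E) : Prop :=
  exists2 c, 0 < c &
    forall t, 2 * p x + c * `|t| <= p (x + t *: y) + p (x - t *: y).

(** [q] is an extension of [p] plus a distance to [range j]. The second term vanishes on [range j]
    and is at least 1 at [y], which creates the corner. *)
Lemma kink_extension (R : realType) (V W : tvsType R) (j : {linear V -> W})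
    (p : V -> R) (y : W) (U : set W) :
  inducing j -> nbhs 0 U -> (forall x, ~ U (y - j x)) ->
  seminorm p -> nbhs 0 [set x | p x < 1] ->
  exists q : W -> R,
    [/\ seminorm q, nbhs 0 [set z | q z < 1], forall x, q (j x) = p x &
        forall x, kink q (j x) y].
Proof.
move=> indj U0 Uy sp np.
(* The unit ball of [p] contains the trace of a neighborhood in [W], so some continuous seminorm [s]
   of [W] dominates [p] on [V]. *)
have [B] := (indj 0 _).1 np; rewrite linear0 => nB Bp.
have [s [ss ns sB]] := gauge_seminorm nB.
have [r [sr nr rU]] := gauge_seminorm U0.
have ps x : p x <= s (j x).
  apply: (seminorm_le_unit_ball sp (seminorm_comp j ss)) => z /= sz.
  by apply: Bp; apply: sB.
have s0 : seminorm (fun _ : V => 0 : R) by split=> *; rewrite ?addr0 ?mulr0.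
pose q1 := infconv j p s; pose q2 := infconv j (fun _ => 0) r.
have sq1 : seminorm q1 by exact: seminorm_infconv.
have sq2 : seminorm q2 by exact: seminorm_infconv.
have q1j x : q1 (j x) = p x by exact: infconv_extends.
have q2j x : q2 (j x) = 0.
  by apply: infconv_extends => // z; exact: seminorm_ge0.
have q2y : 1 <= q2 y.
  apply: le_infconv => x; rewrite add0r leNgt; apply/negP => /rU; exact: Uy.
exists (q1 \+ q2); split=> [||x|x] /=.
- exact: seminorm_add.
- have half_gt0 : 0 < 2^-1 :> R by rewrite invr_gt0.
  apply: filterS (filterI (nbhs_seminorm_ball 0 ss ns half_gt0)
    (nbhs_seminorm_ball 0 sr nr half_gt0)) => z /=; rewrite subr0 => -[sz rz].
  have := infconv_ler j sp ss z; have := infconv_ler j s0 sr z.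
  by rewrite /q1 /q2; lra.
- by rewrite q1j q2j addr0.
(* [q1] contributes [2 * p x] by the triangle inequality; [q2] contributes [|t|] from the point
   [j x + t *: y] alone, whence the constant 1. *)
- exists 1 => // t; rewrite /= q1j q2j addr0 mul1r.
  have := seminormD sq1 (j x + t *: y) (j x - t *: y).
  rewrite addrACA subrr addr0 -mulr2n -scaler_nat (seminormZ _ _ sq1) q1j.
  rewrite ger0_norm //.
  have := seminormD sq2 (j x + t *: y) (- j x).
  rewrite addrC addKr (seminormZ _ _ sq2) (seminormN _ sq2) q2j.
  have := seminorm_ge0 (j x - t *: y) sq2.
  by have := ler_peMr (normr_ge0 t) q2y; lra.
Qed.

(** Near 0 the quotients at [t] and [-t] both lie within [c / 2] of [l y], but a kink makes them
    differ by at least [c]. *)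
Lemma kink_not_gateaux (R : realType) (E : tvsType R) (p : E -> R^o) (x y : E) :
  kink p x y -> ~ gateaux_differentiable_at p x.
Proof.
move=> [c c0 kc] [l _ /(_ y)/cvgrPdist_lt/(_ (c / 2))].
rewrite divr_gt0 // => /(_ isT).
move=> /nbhs_ballP[d /= d0 dl].
have d2 : 0 < d / 2 by rewrite divr_gt0.
have d2n : d / 2 != 0 by rewrite gt_eqF.
have lt_d : d / 2 < d by lra.
have := dl (d / 2); rewrite -ball_normE /= sub0r normrN gtr0_norm //.
move=> /(_ lt_d d2n).
have := dl (- (d / 2)); rewrite -ball_normE /= sub0r opprK gtr0_norm // oppr_eq0.
move=> /(_ lt_d d2n); have := kc (d / 2); rewrite gtr0_norm // scaleNr invrN mulrN.
set u := p (x + (d / 2) *: y); set v := p (x - (d / 2) *: y).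
move: (d / 2) d2 d2n => t t0 tn kt.
rewrite opprK !ltr_norml => /andP[_ h1] /andP[h2 _].
have : c <= (v - p x) / t + (u - p x) / t.
  by rewrite -mulrDl ler_pdivlMr //; lra.
lra.
Qed.

(* [E] with the topology of the single seminorm [p]: it need not be Hausdorff,
   which the finest-topology clause of [inductive_limit] allows. *)
Definition seminormed (R : realType) (E : lmodType R) (p : E -> R)
  (sp : seminorm p) : Type := E.

(** * The locally convex topology of a single seminorm *)

Section seminormed_tvs.
Context {R : realType} {E : lmodType R} (p : E -> R) (sp : seminorm p).
Local Notation F := (seminormed sp).

HB.instance Definition _ := GRing.Lmodule.on F.

Let ent : set_system (F * F) :=
  filter_from [set e : R | 0 < e] (fun e => [set z | p (z.1 - z.2) < e]).

Let ent_filter : Filter ent.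
Proof.
apply: filter_from_filter; first by exists 1 => /=.
move=> e e' /= e0 e'0; exists (Num.min e e'); first by rewrite /= lt_min e0.
by move=> z /=; rewrite lt_min => /andP[].
Qed.

Let ent_diagonal A : ent A -> diagonal `<=` A.
Proof.
move=> [e /= e0 eA] [x y]; rewrite /diagonal /= => ->; apply: eA => /=.
by rewrite subrr seminorm0.
Qed.

Let ent_inv A : ent A -> ent A^-1%relation.
Proof.
move=> [e /= e0 eA]; exists e => // -[x y] /= pe; apply: eA => /=.
by rewrite (seminormB _ _ sp).
Qed.

Let ent_split A : ent A -> exists2 B, ent B & (B \; B)%relation `<=` A.
Proof.
move=> [e /= e0 eA]; exists [set z | p (z.1 - z.2) < e / 2].
  by exists (e / 2); rewrite //= divr_gt0.
move=> [x z] /= [y /= xy yz]; apply: eA => /=.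
by have := seminorm_distD (E := E) y x z sp; lra.
Qed.

HB.instance Definition _ :=
  isUniform.Build F ent_filter ent_diagonal ent_inv ent_split.

Lemma nbhs_seminormedP (x : F) (A : set F) :
  nbhs x A <-> exists2 e, 0 < e & [set y | p (x - y) < e] `<=` A.
Proof.
split=> [[B [e e0 eB] BA]|[e e0 eA]].
  by exists e => // y pe; apply/BA/xsectionP; exact: eB.
exists [set z : F * F | p (z.1 - z.2) < e]; first by exists e.
by move=> y /xsectionP /eA.
Qed.

Let add_cont : continuous (fun z : F * F => z.1 + z.2).
Proof.
move=> [x y] A /nbhs_seminormedP[e e0 eA].
have e2 : 0 < e / 2 by rewrite divr_gt0.
exists ([set x' | p (x - x') < e / 2], [set y' | p (y - y') < e / 2]).
  by split; apply/nbhs_seminormedP; exists (e / 2).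
move=> [x' y'] [/= xx' yy']; apply: eA => /=.
by rewrite opprD addrACA; have := seminormD (E := E) sp (x - x') (y - y'); lra.
Qed.

Let scale_cont : continuous (fun z : R^o * F => z.1 *: z.2).
Proof.
move=> [a x] A /nbhs_seminormedP[e e0 eA].
have px0 := seminorm_ge0 (E := E) x sp; have a0 := normr_ge0 a.
(* The error is at most [d * (|a| + p x + 1)], using [d <= 1] to bound [|b|] by [|a| + 1]; the extra
   unit in the denominator makes it strictly less than [e]. *)
pose d := Num.min 1 (e / (`|a| + p x + 2)).
have d0 : 0 < d by rewrite lt_min ltr01 divr_gt0 //; lra.
have d1 : d <= 1 by rewrite ge_min lexx.
have de : d * (`|a| + p x + 2) <= e.
  by rewrite -ler_pdivlMr ?ge_min ?lexx ?orbT //; lra.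
exists (ball a d, [set x' | p (x - x') < d]).
  by split; [exact: nbhsx_ballx|apply/nbhs_seminormedP; exists d].
move=> [b x'] [/=]; rewrite -ball_normE /= => ab xx'; apply: eA => /=.
have -> : a *: x - b *: x' = (a - b) *: x + b *: (x - x').
  by rewrite scalerBl scalerBr addrA subrK.
have b_le : `|b| <= `|a| + 1.
  by have := ler_distD a b 0; rewrite !subr0 distrC; lra.
have := seminormD (E := E) sp ((a - b) *: x) (b *: (x - x')).
rewrite !(seminormZ _ _ sp) => /le_lt_trans; apply.
have := ler_wpM2r px0 (ltW ab).
have : `|b| * p (x - x') <= (`|a| + 1) * d.
  by apply: ler_pM => //; [exact: (seminorm_ge0 (E := E) _ sp)|exact: ltW].
nra.
Qed.

Let locally_convex_seminormed :
  exists2 B : set_system F, (forall b, b \in B -> convex_set b) & basis B.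
Proof.
exists [set B | exists x e, B = [set y | p (x - y) < e]].
  move=> _ /[!inE] -[x [e ->]] y z t /[!inE] /= py pz.
  have -> : x - conv t (y : convex_lmodType E) (z : convex_lmodType E) =
      t%:num *: (x - y) + (1 - t%:num) *: (x - z).
    by rewrite !scalerBr addrACA -opprD -scalerDl (addrC t%:num) subrK scale1r.
  have t0 : 0 <= 1 - t%:num by rewrite subr_ge0.
  have := seminormD (E := E) sp (t%:num *: (x - y)) ((1 - t%:num) *: (x - z)).
  rewrite !(seminormZ _ _ sp) !ger0_norm // => /le_lt_trans; apply.
  (* Strictness comes from the [y] term when [t] is positive, and from the [z] term when [t] is
     0. *)
  have [->|tp] := eqVneq t%:num 0; first lra.
  have tp' : 0 < t%:num by rewrite lt_neqAle eq_sym tp /=.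
  have := ler_wpM2l t0 (ltW pz).
  have : t%:num * p (x - y) < t%:num * e by rewrite ltr_pM2l.
  lra.
split=> [_ [x [e ->]]|x A /nbhs_seminormedP[e e0 eA]].
  rewrite openE => y /= pe; apply/nbhs_seminormedP.
  exists (e - p (x - y)); first by rewrite subr_gt0.
  by move=> z /=; have := seminorm_distD (E := E) y x z sp; lra.
exists [set y | p (x - y) < e] => //; split; first by exists x, e.
by rewrite /= subrr seminorm0.
Qed.

HB.instance Definition _ :=
  PreTopologicalNmodule_isTopologicalNmodule.Build F add_cont.
HB.instance Definition _ :=
  TopologicalNmodule_isTopologicalLmodule.Build R F scale_cont.
HB.instance Definition _ := Uniform_isTvs.Build R F locally_convex_seminormed.

End seminormed_tvs.

(** * Gluing seminorms along an inductive limit *)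

(** The finest-topology clause applies to the identity from [E] to [E] with the topology of [p]; its
    continuity at 0 is the claim. *)
Lemma inductive_limit_seminorm (R : realType) (E : tvsType R)
    (V : nat -> tvsType R) (i : forall n, {linear V n -> E}) (p : E -> R) :
  inductive_limit i -> seminorm p ->
  (forall n, nbhs 0 [set x | p (i n x) < 1]) -> nbhs 0 [set x | p x < 1].
Proof.
move=> [_ _ _ univ] sp np.
pose phi := (idfun : {linear E -> seminormed sp}).
have phi_cont : continuous phi.
  apply: univ; first by exists id.
  move=> n x A /nbhs_seminormedP[e e0 eA].
  apply: filterS (nbhs_seminorm_ball x (seminorm_comp (i n) sp) (np n) e0).
  move=> y /= ye; apply: eA => /=; rewrite (seminormB _ _ sp) -linearB.
  exact: ye.
apply: (phi_cont 0 [set x | p x < 1]); apply/nbhs_seminormedP; exists 1 => // y /=.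
by rewrite sub0r seminormN.
Qed.

(** Turns an inclusion of subspaces of [E] into a map between the spaces themselves; injectivity of
    [i'] forces linearity. *)
Lemma range_subset_factor (R : realType) (E V W : lmodType R)
    (i : {linear V -> E}) (i' : {linear W -> E}) :
  injective i' -> range i `<=` range i' ->
  exists j : {linear V -> W}, forall x, i' (j x) = i x.
Proof.
move=> i'inj sub.
have /choice[f fE] : forall x, exists y, i' y = i x.
  by move=> x; have [y _ <-] := sub (i x) (imageP _ I); exists y.
have f_lin : linear f.
  by move=> a x y; apply: i'inj; rewrite linearP !fE linearP.
pose j : {linear V -> W} := HB.pack f (GRing.isLinear.Build R V W *:%R f f_lin).
by exists j.
Qed.

Lemma kinked_seminorm_strict_LF (R : realType) (E : tvsType R) :
  strict_LF_space E -> exists p : E -> R,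
    [/\ seminorm p, nbhs 0 [set x | p x < 1] & forall x, exists y, kink p x y].
Proof.
move=> [_ [V [i [[lim frechetV strict] io]]]].
have [[hausV inj_i sub_i _] cover_i _ _] := lim.
have /all_sig[y yP] n : {y : V n.+1 | ~ range (i n) (i n.+1 y)}.
  apply: cid; have [_ /existsNP[z /not_implyP[[y _ <-] nz]]] := strict n.
  by exists y.
pose csn n := {q : V n -> R | seminorm q /\ nbhs 0 [set x | q x < 1]}.
(* Compatibility is phrased through images in [E], so that later steps need no transition maps
   between levels. *)
have step n (q : csn n) : {q' : csn n.+1 | forall x x',
    i n.+1 x' = i n x -> sval q' x' = sval q x /\ kink (sval q') x' (y n)}.
  apply: cid; case: q => q [sq nq] /=.
  have [j ij] := range_subset_factor (inj_i n.+1) (sub_i n).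
  have indj := restricted_open_inducing (inj_i n.+1) ij (io n).
  have [_ _ complV] := frechetV n.
  have yj : ~ range j (y n).
    by move=> [x _ xy]; apply: (yP n); exists x; rewrite -?ij ?xy.
  have [U U0 Uy] := complete_range_separated indj complV (hausV n.+1) yj.
  have [q' [sq' nq' q'j q'k]] := kink_extension indj U0 Uy sq nq.
  exists (exist _ q' (conj sq' nq')) => x x' /=; rewrite -ij => /inj_i ->.
  by split.
(* The recursion may start from the zero seminorm: kinks come from the later levels. *)
have csn0 : csn 0%N.
  exists (fun=> 0); split; first by split=> *; rewrite ?addr0 ?mulr0.
  by apply: filterS (@filterT _ (nbhs 0) _) => x _ /=.
pose P : forall n, csn n := fix P n :=
  if n is m.+1 then sval (step m (P m)) else csn0.
have PS n x x' : i n.+1 x' = i n x ->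
    sval (P n.+1) x' = sval (P n) x /\ kink (sval (P n.+1)) x' (y n).
  exact: (svalP (step n (P n))).
have mono n m : (n <= m)%N -> range (i n) `<=` range (i m).
  apply: (homo_leq (f := fun n => range (i n)) (r := subset)).
  - by move=> A x.
  - by move=> B A C; exact: subset_trans.
  - exact: sub_i.
have PE n m x x' : (n <= m)%N -> i m x' = i n x -> sval (P m) x' = sval (P n) x.
  elim: m x' => [|m IH] x'.
    by rewrite leqn0 => /eqP n0; subst n => /inj_i ->.
  rewrite leq_eqVlt => /predU1P[nm|]; first by subst n => /inj_i ->.
  rewrite ltnS => nm x'x.
  have [z _ zx] : range (i m) (i n x) by apply: mono nm _ _; exists x.
  by rewrite -(IH z nm zx); have [] := PS m z x' (etrans x'x (esym zx)).
have cover x : exists nz : {n & V n}, i (tag nz) (tagged nz) = x.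
  have [n _ [z _ zx]] : (\bigcup_n range (i n)) x by rewrite cover_i.
  by exists (Tagged V z).
have {cover}/choice[pre preE] := cover.
(* [p] reads [x] at a chosen level; by [PE] any other level gives the same value. *)
pose p x := sval (P (tag (pre x))) (tagged (pre x)).
have pE n z : p (i n z) = sval (P n) z.
  have [le|/ltnW le] := leqP (tag (pre (i n z))) n; last exact: PE.
  by symmetry; apply: PE.
have lift x n : (tag (pre x) <= n)%N -> exists z, i n z = x.
  move=> xn; have [z _ zx] : range (i n) x.
    by apply: (mono _ _ xn); exists (tagged (pre x)).
  by exists z.
have sp : seminorm p.
  split=> [u v|a u].
    have [n [un vn]] : exists n, (tag (pre u) <= n)%N /\ (tag (pre v) <= n)%N.
      by exists (maxn (tag (pre u)) (tag (pre v))); rewrite leq_maxl leq_maxr.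
    have [[a <-] [b <-]] := (lift u n un, lift v n vn).
    by rewrite -linearD !pE; apply: seminormD (svalP (P n)).1 _ _.
  have [b <-] := lift u _ (leqnn _).
  by rewrite -linearZ !pE; apply: seminormZ_le (svalP (P _)).1 _ _.
exists p; split=> //.
  apply: (inductive_limit_seminorm lim sp) => n.
  by apply: filterS (svalP (P n)).2 => z; rewrite /= pE.
move=> x; have [n [z <-]] : exists n z, i n z = x.
  by exists (tag (pre x)), (tagged (pre x)).
(* The kink along [y n] belongs to level [n.+1], so the point is first lifted one level. *)
have [z' _ z'z] : range (i n.+1) (i n z) by apply: sub_i; exists z.
have [_ [c c0 cP]] := PS n z z' z'z.
exists (i n.+1 (y n)), c => // t.
by rewrite -z'z -!linearZ -linearD -linearB !pE.
Qed.

Theorem corollary3p11 (R : realType) (E : tvsType R)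
  (E_strict_LF : strict_LF_space E)
  (E_infinite_dim : ~ finite_dimensional E) :
  ~ gateaux_differentiability_space E.
Proof.
have [p [sp np kinkp]] := kinked_seminorm_strict_LF E_strict_LF.
move=> /(_ setT p) gds.
have /(_ 0 I) : [set: E] `<=`
    closure (setT `&` [set x | gateaux_differentiable_at p x]).
  apply: gds.
  - by exists 0.
  - exact: openT.
  - by move=> x y t _ _; rewrite inE.
  - exact/continuous_subspaceT/(continuous_seminorm sp np).
  - exact: convex_seminorm.
(* The whole space is a neighborhood of 0, so density yields a point of differentiability, but every
   point has a kink. *)
move=> /(_ setT filterT)[x [[_ gx] _]].
by have [y /kink_not_gateaux] := kinkp x; apply.
Qed.
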